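(* Let $R$ be a ring, let $C=\mathrm{Cent}(R)$ and let $\sigma\in\mathrm{Aut}(C)$. Then $R$ is Morita equivalent over $C$ to a (necessarily central) $C$-algebra with an anti-automorphism of type $\sigma$ if and only if there exists a regular bilinear space $(M,b,K)$ over $R$ such that $M$ is a right $R$-progenerator and $K$ is a double $R$-progenerator of type $\sigma$.
   Context: Rings are unital, possibly non-commutative. $\mathrm{Cent}(R)$ is the center of $R$, $R^{\mathrm{op}}$ the opposite ring. A right $R$-progenerator is a finitely generated projective right $R$-module that is a generator. An $(S,R)$-progenerator is an $(S,R)$-bimodule $P$ such that $P_R$ is a progenerator and every endomorphism of $P_R$ has the form $p\mapsto sp$ for a unique $s\in S$. If $R,S$ are $C$-algebras ($C$ commutative), they are Morita equivalent over $C$ if there is an $(S,R)$-progenerator $P$ with $cp=pc$ for all $c\in C$, $p\in P$. A $C$-algebra $S$ is central if $c\mapsto c\cdot 1_S$ is an isomorphism $C\to\mathrm{Cent}(S)$; the type of an anti-automorphism of a central $C$-algebra is its restriction to the center, viewed as an automorphism of $C$. A double $R$-module is an additive group $K$ with two right $R$-module structures $\odot_0,\odot_1:K\times R\to K$ satisfying $(k\odot_0 a)\odot_1 b=(k\odot_1 b)\odot_0 a$ for all $k\in K$, $a,b\in R$; $K_i$ denotes $K$ as a right $R$-module via $\odot_i$. A double $R$-module is viewed as an $(R^{\mathrm{op}},R)$-bimodule via $a^{\mathrm{op}}\cdot k\cdot b=k\odot_0 b\odot_1 a$, and it is called a double $R$-progenerator if this bimodule is an $(R^{\mathrm{op}},R)$-progenerator.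 Its type is the automorphism $\sigma$ of $\mathrm{Cent}(R)$ satisfying $k\odot_0 c=k\odot_1\sigma(c)$ for all $k\in K$, $c\in\mathrm{Cent}(R)$. A bilinear space over $R$ is a triple $(M,b,K)$ with $M$ a right $R$-module, $K$ a double $R$-module and $b:M\times M\to K$ biadditive with $b(xr,y)=b(x,y)\odot_0 r$ and $b(x,yr)=b(x,y)\odot_1 r$. It is regular if both adjoint maps $M\to\mathrm{Hom}_R(M,K_1)$, $x\mapsto b(x,-)$, and $M\to\mathrm{Hom}_R(M,K_0)$, $x\mapsto b(-,x)$, are bijective. *)

(* Defs.v *)
From HB Require Import structures.
From mathcomp Require Import all_boot all_algebra.
From mathcomp Require Import boolp.

Set Implicit Arguments.
Unset Strict Implicit.
Unset Printing Implicit Defensive.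

Import GRing.Theory.
Local Open Scope ring_scope.

(* Rings are pzRingType's, so the zero ring is allowed. The opposite ring of R
   is R^c, and a right R-module is an lmodType R^c. *)

Section Center.
Variable R : pzRingType.

Definition in_center : {pred R} :=
  [pred x : R | `[< forall y : R, GRing.comm x y >]].

Lemma in_centerP (x : R) :
  reflect (forall y : R, x * y = y * x) (x \in in_center).
Proof. exact: asboolP. Qed.

Fact in_center_subring : subring_closed in_center.
Proof.
split.
- by apply/in_centerP => y; rewrite mul1r mulr1.
- move=> a b /in_centerP ha /in_centerP hb; apply/in_centerP => y.
  by rewrite mulrBl mulrBr ha hb.
- move=> a b /in_centerP ha /in_centerP hb; apply/in_centerP => y.
  by rewrite -mulrA hb mulrA ha mulrA.
Qed.

HB.instance Definition _ :=
  GRing.isSubringClosed.Build R in_center in_center_subring.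

Record center : Type := Center { center_val : R; _ : center_val \in in_center }.

HB.instance Definition _ := [isSub for center_val].
HB.instance Definition _ := [Choice of center by <:].
HB.instance Definition _ := GRing.SubChoice_isSubPzRing.Build R in_center center
  (subringClosedP in_center).

Fact center_mulC : commutative (@GRing.mul center).
Proof.
move=> a b; apply: val_inj; rewrite !rmorphM /=.
exact: (in_centerP _ (valP a)).
Qed.

HB.instance Definition _ :=
  GRing.PzRing_hasCommutativeMul.Build center center_mulC.

End Center.

(* The library's algType C forces the underlying ring to be nonzero, whence
   this variant: a ring with a structure map c |-> c * 1 of central image. *)
Record algebraOver (C : comPzRingType) := AlgebraOver {
  alg_ring :> pzRingType;
  alg_map : {rmorphism C -> alg_ring};
  alg_map_center : forall c : C, alg_map c \in @in_center alg_ring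
}.

Definition to_center (C : comPzRingType) (S : algebraOver C) (c : C) :
  center S := Center (alg_map_center S c).

Definition central (C : comPzRingType) (S : algebraOver C) : Prop :=
  bijective (@to_center C S).

Fact center_map_center (R : pzRingType) (c : center R) :
  (val : {rmorphism center R -> R}) c \in @in_center R.
Proof. exact: (valP c). Qed.

Definition self_algebra (R : pzRingType) : algebraOver (center R) :=
  AlgebraOver (@center_map_center R).

(* An anti-automorphism of S is a bijective ring morphism S -> S^c.  When S is
   central over C, it maps Cent(S) = C * 1 to itself, and its type is the
   corresponding automorphism of C. *)
Definition antiaut_of_type (C : comPzRingType) (S : algebraOver C)
    (theta : {rmorphism S -> S^c}) (sigma : C -> C) : Prop :=
  forall c : C, theta (alg_map S c) = alg_map S (sigma c).

Section RightModules.
Variable R : pzRingType.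

Definition rscale (M : lmodType R^c) (x : M) (r : R) : M := (r : R^c) *: x.

Definition finitely_generated (M : lmodType R^c) : Prop :=
  exists (n : nat) (v : 'I_n -> M), forall x : M,
    exists a : 'I_n -> R, x = \sum_i rscale (v i) (a i).

Definition projective (M : lmodType R^c) : Prop :=
  forall (A B : lmodType R^c) (g : {linear A -> B}) (f : {linear M -> B}),
    (forall y : B, exists x : A, g x = y) ->
    exists h : {linear M -> A}, forall x : M, g (h x) = f x.

(* The functor Hom_R(M, -) is faithful. *)
Definition generator (M : lmodType R^c) : Prop :=
  forall (A B : lmodType R^c) (f g : {linear A -> B}),
    (forall (h : {linear M -> A}) (x : M), f (h x) = g (h x)) -> f =1 g.

Definition progenerator (M : lmodType R^c) : Prop :=
  [/\ finitely_generated M, projective M & generator M].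

Record right_action (V : zmodType) (op : V -> R -> V) : Prop := RightAction {
  ractA : forall v a b, op (op v a) b = op v (a * b);
  ract1 : forall v, op v 1 = v;
  ractDl : forall u v a, op (u + v) a = op u a + op v a;
  ractDr : forall v a b, op v (a + b) = op v a + op v b
}.

Definition rmod_sort (V : zmodType) (op : V -> R -> V) (_ : right_action op) :
  Type := V.

Section RmodOf.
Variables (V : zmodType) (op : V -> R -> V) (H : right_action op).

HB.instance Definition _ := GRing.Zmodule.on (rmod_sort H).

Let scale (a : R^c) (v : rmod_sort H) : rmod_sort H := op v a.

Fact rmod_scalerA a b v : scale a (scale b v) = scale (a * b) v.
Proof. exact: (ractA H). Qed.
Fact rmod_scale1r : left_id 1 scale.
Proof. exact: (ract1 H). Qed.
Fact rmod_scalerDr : right_distributive scale +%R.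
Proof. by move=> a u v; exact: (ractDl H). Qed.
Fact rmod_scalerDl v : {morph scale^~ v : a b / a + b}.
Proof. by move=> a b; exact: (ractDr H). Qed.

HB.instance Definition _ := GRing.Zmodule_isLmodule.Build R^c (rmod_sort H)
  rmod_scalerA rmod_scale1r rmod_scalerDr rmod_scalerDl.

Definition rmod_of : lmodType R^c := rmod_sort H.

End RmodOf.
End RightModules.

Record bimodule (S R : pzRingType) := Bimodule {
  bimod_rmod :> lmodType R^c;
  lact : S -> bimod_rmod -> bimod_rmod;
  lactA : forall s t p, lact s (lact t p) = lact (s * t) p;
  lact1 : forall p, lact 1 p = p;
  lactDr : forall s p q, lact s (p + q) = lact s p + lact s q;
  lactDl : forall s t p, lact (s + t) p = lact s p + lact t p;
  lact_rscale : forall s p (r : R), lact s (rscale p r) = rscale (lact s p) r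
}.

Definition bimod_progenerator (S R : pzRingType) (P : bimodule S R) : Prop :=
  progenerator P /\
  forall f : {linear P -> P}, exists! s : S, forall p : P, f p = lact s p.

Definition morita_equivalent_over (C : comPzRingType) (R S : algebraOver C) :
    Prop :=
  exists P : bimodule S R, bimod_progenerator P /\
    forall (c : C) (p : P), lact (alg_map S c) p = rscale p (alg_map R c).

Record doubleModule (R : pzRingType) := DoubleModule {
  dm_zmod :> zmodType;
  op0 : dm_zmod -> R -> dm_zmod;
  op1 : dm_zmod -> R -> dm_zmod;
  op0_action : right_action op0;
  op1_action : right_action op1;
  op_comm : forall k a b, op1 (op0 k a) b = op0 (op1 k b) a
}.

Section DoubleModules.
Variables (R : pzRingType) (K : doubleModule R).

Definition dmod0 : lmodType R^c := rmod_of (op0_action K).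
Definition dmod1 : lmodType R^c := rmod_of (op1_action K).

Let dm_lact (a : R^c) (k : dmod0) : dmod0 := @op1 R K k a.

Fact dm_lactA a b k : dm_lact a (dm_lact b k) = dm_lact (a * b) k.
Proof. exact: (ractA (op1_action K)). Qed.
Fact dm_lact1 k : dm_lact 1 k = k.
Proof. exact: (ract1 (op1_action K)). Qed.
Fact dm_lactDr a k l : dm_lact a (k + l) = dm_lact a k + dm_lact a l.
Proof. exact: (ractDl (op1_action K)). Qed.
Fact dm_lactDl a b k : dm_lact (a + b) k = dm_lact a k + dm_lact b k.
Proof. exact: (ractDr (op1_action K)). Qed.
Fact dm_lact_rscale a k (r : R) :
  dm_lact a (rscale k r) = rscale (dm_lact a k) r.
Proof. exact: op_comm. Qed.

(* a^op . k . b = (k op0 b) op1 a *)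
Definition dm_bimodule : bimodule R^c R :=
  Bimodule dm_lactA dm_lact1 dm_lactDr dm_lactDl dm_lact_rscale.

Definition double_progenerator : Prop := bimod_progenerator dm_bimodule.

Definition double_module_of_type (sigma : center R -> center R) : Prop :=
  forall (k : K) (c : center R), op0 k (val c) = op1 k (val (sigma c)).

End DoubleModules.

Record bilinearSpace (R : pzRingType) := BilinearSpace {
  bs_mod : lmodType R^c;
  bs_dmod : doubleModule R;
  bs_form : bs_mod -> bs_mod -> bs_dmod;
  bs_formDl : forall x x' y, bs_form (x + x') y = bs_form x y + bs_form x' y;
  bs_formDr : forall x y y', bs_form x (y + y') = bs_form x y + bs_form x y';
  bs_formZl : forall x y (r : R),
    bs_form (rscale x r) y = op0 (bs_form x y) r;
  bs_formZr : forall x y (r : R),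
    bs_form x (rscale y r) = op1 (bs_form x y) r
}.

Section Regular.
Variables (R : pzRingType) (B : bilinearSpace R).
Local Notation M := (bs_mod B).
Local Notation K0 := (dmod0 (bs_dmod B)).
Local Notation K1 := (dmod1 (bs_dmod B)).

Definition adj1_fun (x : M) : M -> K1 := fun y => bs_form x y.
Definition adj0_fun (y : M) : M -> K0 := fun x => bs_form x y.

Fact adj1_linear x : linear (adj1_fun x).
Proof.
move=> a u v; rewrite /adj1_fun bs_formDr; congr (_ + _); exact: bs_formZr.
Qed.
Fact adj0_linear y : linear (adj0_fun y).
Proof.
move=> a u v; rewrite /adj0_fun bs_formDl; congr (_ + _); exact: bs_formZl.
Qed.

HB.instance Definition _ x :=
  GRing.isLinear.Build R^c M K1 *:%R (adj1_fun x) (adj1_linear x).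
HB.instance Definition _ y :=
  GRing.isLinear.Build R^c M K0 *:%R (adj0_fun y) (adj0_linear y).

Definition adj1 (x : M) : {linear M -> K1} := adj1_fun x.
Definition adj0 (y : M) : {linear M -> K0} := adj0_fun y.

Definition regular : Prop := bijective adj1 /\ bijective adj0.

End Regular.

(* Main.v *)
(** From a regular form b on M one reads off an anti-automorphism of
    S = End_R(M), namely s |-> s' with b(s x, y) = b(x, s' y); its type is
    that of K.  Conversely, let P be an (S,R)-progenerator and theta an
    anti-automorphism of S.  One takes M = P and for b the universal biadditive
    map with b(theta^-1(s) x, y) = b(x, s y), that is K = P' (x)_S P, where P'
    is P with the right S-action p s = theta^-1(s) p.  Since P is the S-dual of
    Q = Hom_R(P, R), this K is Hom_S(Q, P'), and
    b(x, y)(q) = theta^-1([y q]) x, where [y q] in S acts on P by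
    p |-> y q(p).  All required properties of K and b then follow from two
    finite families: a dual basis, sum x_i phi_i(p) = p, and a trace identity,
    sum psi_j(y_j) = 1; the latter also gives the double centralizer property
    End_S(P) = R. *)
From HB Require Import structures.
From mathcomp Require Import all_boot all_algebra.
From mathcomp Require Import boolp.
Require Import Defs.

Set Implicit Arguments.
Unset Strict Implicit.
Unset Printing Implicit Defensive.

Import GRing.Theory.
Local Open Scope ring_scope.
Local Open Scope quotient_scope.

Lemma morphD_sum (U V : zmodType) (f : U -> V) I (r : seq I) (F : I -> U) :
  {morph f : x y / x + y} -> f (\sum_(i <- r) F i) = \sum_(i <- r) f (F i).
Proof.
move=> fD; apply: (big_morph f fD).
by apply: (addrI (f 0)); rewrite -fD !addr0.
Qed.

(** * Additive groups and endomorphism rings of linear maps *)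

Section LinearMaps.
Variable A : pzRingType.

(** Proof irrelevance removes the bundled axioms. Bijectivity in [regular] concerns equality of
    bundled maps, so this reduction to values is needed. *)
Lemma linear_eq (U V : lmodType A) (f g : {linear U -> V}) : f =1 g -> f = g.
Proof.
case: f g => [f [[a] [b]]] [g [[c] [d]]] /= fg.
have {fg} fg : f = g by apply: funext.
by subst g; rewrite (Prop_irrelevance a c) (Prop_irrelevance b d).
Qed.

Definition linear_of (U V : lmodType A) (f : U -> V) (f_lin : linear f) :
    {linear U -> V} :=
  HB.pack f (GRing.isLinear.Build A U V *:%R f f_lin).

Section Zmodule.
Variables U V : lmodType A.
Implicit Types f g h : {linear U -> V}.

HB.instance Definition _ := gen_eqMixin {linear U -> V}.
HB.instance Definition _ := gen_choiceMixin {linear U -> V}.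

Let hom0 : {linear U -> V} := \0.
Let homN f : {linear U -> V} := \- f.
Let homD f g : {linear U -> V} := f \+ g.

Fact hom_addrA : associative homD.
Proof. by move=> f g h; apply: linear_eq => x /=; rewrite addrA. Qed.
Fact hom_addrC : commutative homD.
Proof. by move=> f g; apply: linear_eq => x /=; rewrite addrC. Qed.
Fact hom_add0r : left_id hom0 homD.
Proof. by move=> f; apply: linear_eq => x /=; rewrite add0r. Qed.
Fact hom_addNr : left_inverse hom0 homN homD.
Proof. by move=> f; apply: linear_eq => x /=; rewrite addNr. Qed.

HB.instance Definition _ := GRing.isZmodule.Build {linear U -> V}
  hom_addrA hom_addrC hom_add0r hom_addNr.

Lemma sum_linearE (I : Type) (r : seq I) (F : I -> {linear U -> V}) x :
  (\sum_(i <- r) F i) x = \sum_(i <- r) F i x.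
Proof. by elim/big_rec2: _ => // i y f _ <-. Qed.

End Zmodule.

Section Endomorphisms.
Variable M : lmodType A.
Implicit Types f g h : {linear M -> M}.

Let end1 : {linear M -> M} := idfun.
Let endM f g : {linear M -> M} := f \o g.

Fact end_mulrA : associative endM.
Proof. by move=> f g h; apply: linear_eq. Qed.
Fact end_mul1r : left_id end1 endM.
Proof. by move=> f; apply: linear_eq. Qed.
Fact end_mulr1 : right_id end1 endM.
Proof. by move=> f; apply: linear_eq. Qed.
Fact end_mulrDl : left_distributive endM +%R.
Proof. by move=> f g h; apply: linear_eq. Qed.
Fact end_mulrDr : right_distributive endM +%R.
Proof. by move=> f g h; apply: linear_eq => x; exact: raddfD. Qed.

HB.instance Definition _ := GRing.Zmodule_isPzRing.Build {linear M -> M}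
  end_mulrA end_mul1r end_mulr1 end_mulrDl end_mulrDr.

End Endomorphisms.
End LinearMaps.

(** * Quotient modules *)

Section QuotientModule.
Variables (A : pzRingType) (V : lmodType A) (I : {pred V}).
Hypothesis I_sub : submod_closed I.

Let J : zmodClosed V :=
  HB.pack I (GRing.isZmodClosed.Build V I (GRing.submod_closedB I_sub)).

Definition quotient_module : Type := Quotient.quot J.
HB.instance Definition _ := GRing.Zmodule.on quotient_module.

Let pi (v : V) : quotient_module := \pi_(Quotient.quot J) v.
Let scale a (x : quotient_module) : quotient_module :=
  pi (a *: repr (x : Quotient.quot J)).

Let pi_surj x : exists v, x = pi v.
Proof. by exists (repr (x : Quotient.quot J)); rewrite /pi reprK. Qed.

Let piD : {morph pi : u v / u + v}.
Proof. exact: Quotient.pi_add. Qed.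

Let scale_pi a v : scale a (pi v) = pi (a *: v).
Proof.
apply/eqP; rewrite -Quotient.idealrBE -scalerBr.
have [_ ZI] := GRing.submod_closed_semi I_sub.
have: repr (pi v : Quotient.quot J) - v \in J by rewrite Quotient.idealrBE reprK.
exact: ZI.
Qed.

Fact quotient_scalerA a b v : scale a (scale b v) = scale (a * b) v.
Proof. by have [u ->] := pi_surj v; rewrite !scale_pi scalerA. Qed.
Fact quotient_scale1r : left_id 1 scale.
Proof. by move=> v; have [u ->] := pi_surj v; rewrite scale_pi scale1r. Qed.
Fact quotient_scalerDr : right_distributive scale +%R.
Proof.
move=> a v w; have [u ->] := pi_surj v; have [u' ->] := pi_surj w.
by rewrite -piD !scale_pi scalerDr piD.
Qed.
Fact quotient_scalerDl v : {morph scale^~ v : a b / a + b}.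
Proof.
by move=> a b; have [u ->] := pi_surj v; rewrite !scale_pi scalerDl piD.
Qed.

HB.instance Definition _ := GRing.Zmodule_isLmodule.Build A quotient_module
  quotient_scalerA quotient_scale1r quotient_scalerDr quotient_scalerDl.

Fact quotient_pi_linear : linear pi.
Proof. by move=> a u v; rewrite piD -scale_pi. Qed.

Definition quotient_pi : {linear V -> quotient_module} :=
  linear_of quotient_pi_linear.

Lemma quotient_pi_eq0 v : quotient_pi v = 0 <-> v \in I.
Proof.
have -> : (v \in I) = (v - 0 \in J) by rewrite subr0.
by rewrite Quotient.idealrBE -(raddf0 quotient_pi); split=> /eqP.
Qed.

End QuotientModule.

(** * Dual modules, dual bases and the trace identity *)

Notation dual M := {linear M -> (_^c)^o}.

Section Duals.
Variable R : pzRingType.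
Implicit Types M : lmodType R^c.

(** The codomain [(R^c)^o] is R as a right module over itself; [ev] types the value in R, so that
    products are read there and not in [R^c]. *)
Definition ev M (phi : dual M) (x : M) : R := phi x.

Lemma evDr M (phi : dual M) x y : ev phi (x + y) = ev phi x + ev phi y.
Proof. exact: raddfD. Qed.

Lemma evZ M (phi : dual M) x r : ev phi (rscale x r) = ev phi x * r.
Proof. exact: (linearZZ phi (r : R^c) x). Qed.

Lemma evDl M (phi psi : dual M) x : ev (phi + psi) x = ev phi x + ev psi x.
Proof. by []. Qed.

Lemma ev_sumr M (phi : dual M) I (r : seq I) (F : I -> M) :
  ev phi (\sum_(i <- r) F i) = \sum_(i <- r) ev phi (F i).
Proof. exact: raddf_sum. Qed.

Lemma ev_suml M I (r : seq I) (F : I -> dual M) x :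
  ev (\sum_(i <- r) F i) x = \sum_(i <- r) ev (F i) x.
Proof. exact: (sum_linearE r F x). Qed.

Lemma rscaleA M (x : M) a b : rscale (rscale x a) b = rscale x (a * b).
Proof. exact: scalerA. Qed.
Lemma rscale1 M (x : M) : rscale x 1 = x.
Proof. exact: scale1r. Qed.
Lemma rscaleDl M (x y : M) a : rscale (x + y) a = rscale x a + rscale y a.
Proof. exact: scalerDr. Qed.
Lemma rscaleDr M (x : M) a b : rscale x (a + b) = rscale x a + rscale x b.
Proof. exact: scalerDl. Qed.
Lemma rscale_suml M I (r : seq I) (F : I -> M) a :
  rscale (\sum_(i <- r) F i) a = \sum_(i <- r) rscale (F i) a.
Proof. exact: scaler_sumr. Qed.
Lemma rscale_sumr M (x : M) I (r : seq I) (F : I -> R) :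
  rscale x (\sum_(i <- r) F i) = \sum_(i <- r) rscale x (F i).
Proof. exact: scaler_suml. Qed.
Lemma linear_rscale M (N : lmodType R^c) (f : {linear M -> N}) x r :
  f (rscale x r) = rscale (f x) r.
Proof. exact: (linearZZ f (r : R^c) x). Qed.

Definition dual_basis M (s : seq (M * dual M)) :=
  forall x, \sum_(z <- s) rscale z.1 (ev z.2 x) = x.

Definition trace_one M (s : seq (M * dual M)) :=
  \sum_(z <- s) ev z.2 z.1 = 1.

(** Generators give a surjection from a free module onto M; projectivity splits it, and the
    coordinates of the section are the functionals. *)
Lemma dual_basis_exists M :
  finitely_generated M -> projective M ->
  exists s : seq (M * dual M), dual_basis s.
Proof.
move=> [n [v gen]] proj.
pose g0 (a : {ffun 'I_n -> (R^c)^o}) := \sum_i rscale (v i) (a i).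
have g_lin : linear g0.
  move=> c a b; rewrite /g0 scaler_sumr -big_split; apply: eq_bigr => i _ /=.
  by rewrite !ffunE rscaleDr -rscaleA.
have [|h hP] := proj _ _ (linear_of g_lin) idfun.
  move=> y; have [a ->] := gen y; exists [ffun i => a i].
  by apply: eq_bigr => i _; rewrite ffunE.
have c_lin i : linear (fun x => h x i).
  by move=> c x y; rewrite linearP !ffunE.
exists [seq (v i, linear_of (c_lin i)) | i <- index_enum 'I_n] => x.
by rewrite big_map -[RHS]hP.
Qed.

(** Let T be the trace ideal. The projection R -> R/T and the zero map agree after every map M -> R,
    so the generator property makes them equal, and 1 lies in T. *)
Lemma trace_one_exists M :
  generator M -> exists s : seq (M * dual M), trace_one s.
Proof.
move=> gen.
pose T : {pred (R^c)^o} := [pred r | `[< exists s : seq (M * dual M),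
  r = \sum_(z <- s) ev z.2 z.1 >]].
have TP r : reflect (exists s : seq (M * dual M), r = \sum_(z <- s) ev z.2 z.1)
  (r \in T) by exact: asboolP.
have T_sub : submod_closed T.
  split=> [|c _ _ /TP[s ->] /TP[t ->]]; apply/TP.
    by exists [::]; rewrite big_nil.
  exists ([seq (rscale z.1 (c : R), z.2) | z <- s] ++ t).
  rewrite big_cat big_map /=; congr (_ + _).
  rewrite [LHS](mulr_suml (R := R)).
  by apply: eq_bigr => z _; rewrite evZ.
have /quotient_pi_eq0/TP[s sP] : quotient_pi T_sub 1 = 0; last by exists s.
apply: (gen _ _ (quotient_pi T_sub) \0) => h x.
by apply/quotient_pi_eq0/TP; exists [:: (x, h)]; rewrite big_seq1.
Qed.

(** Turns the three categorical conditions into two finite families, the form used in the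
    computations below. *)
Lemma progenerator_bases M :
  progenerator M <-> (exists s : seq (M * dual M), dual_basis s) /\
                     (exists t : seq (M * dual M), trace_one t).
Proof.
split=> [[fg proj gen]|[[s sP] [t tP]]].
  by split; [exact: dual_basis_exists | exact: trace_one_exists].
split.
- exists (size s), (fun i => (tnth (in_tuple s) i).1) => x.
  exists (fun i => ev (tnth (in_tuple s) i).2 x).
  by rewrite -[LHS]sP big_tnth.
- move=> A B g f g_surj.
  have [c cP] := choice (fun z : M * dual M => g_surj (f z.1)).
  (* Chosen preimages of the f(x_i) are combined with the coordinates phi_i. *)
  pose h0 x := \sum_(z <- s) rscale (c z) (ev z.2 x).
  have h_lin : linear h0.
    move=> a x y; rewrite /h0 scaler_sumr -big_split; apply: eq_bigr => z _ /=.
    by rewrite evDr rscaleDr (evZ z.2 x a) -rscaleA.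
  exists (linear_of h_lin) => x; rewrite -[in RHS](sP x).
  rewrite [LHS](linear_sum g) linear_sum.
  by apply: eq_bigr => z _; rewrite !linear_rscale cP.
- move=> A B f g fg a.
  (* The element a is the sum of the values at y_j of the maps x |-> a psi_j(x) from M to A, and f
     and g agree on such values. *)
  have h_lin (phi : dual M) : linear (fun x => rscale a (ev phi x)).
    by move=> c x y; rewrite evDr rscaleDr (evZ phi x c) -rscaleA.
  rewrite -(rscale1 a) -tP rscale_sumr !linear_sum.
  by apply: eq_bigr => z _; exact: (fg (linear_of (h_lin z.2))).
Qed.

End Duals.

(** * The Morita context of an (S,R)-progenerator *)

Section Morita.
Variables (S R : pzRingType) (P : bimodule S R).
Hypothesis P_progen : bimod_progenerator P.

Lemma lact_sumr s I (r : seq I) (F : I -> P) :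
  lact s (\sum_(i <- r) F i) = \sum_(i <- r) lact s (F i).
Proof. exact: morphD_sum (lactDr s). Qed.

Lemma lact_suml I (r : seq I) (F : I -> S) (p : P) :
  lact (\sum_(i <- r) F i) p = \sum_(i <- r) lact (F i) p.
Proof. by apply: (morphD_sum (f := fun s => lact s p)) => s t; exact: lactDl. Qed.

Fact lact_linear (s : S) : linear (@lact S R P s).
Proof. by move=> a p q; rewrite lactDr; congr (_ + _); exact: lact_rscale. Qed.

(** This is uniqueness of the representing element, applied to the endomorphism [lact s]. Identities
    in S are checked on P through it. *)
Lemma lact_inj (s t : S) : (forall p : P, lact s p = lact t p) -> s = t.
Proof.
move=> st; have [_ /(_ (linear_of (lact_linear s)))[u [_ uP]]] := P_progen.
by rewrite -(uP s) // -(uP t).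
Qed.

Lemma endo_lact_exists (f : {linear P -> P}) : exists s, forall p, lact s p = f p.
Proof. by have [_ /(_ f)[s [sP _]]] := P_progen; exists s. Qed.

Definition endo_lact (f : {linear P -> P}) : S :=
  projT1 (cid (endo_lact_exists f)).

Lemma endo_lactE f p : lact (endo_lact f) p = f p.
Proof. exact: (projT2 (cid (endo_lact_exists f))). Qed.

(** The trace identity gives a = sum psi_j(y_j) a = sum psi_j(y_j a). *)
Lemma rscale_inj (a b : R) : (forall p : P, rscale p a = rscale p b) -> a = b.
Proof.
move=> ab; have [/progenerator_bases[_ [t tP]] _] := P_progen.
rewrite -[a]mul1r -[b]mul1r -tP !mulr_suml.
by apply: eq_bigr => z _; rewrite -!evZ ab.
Qed.

Fact rank1_linear (y : P) (q : dual P) : linear (fun p : P => rscale y (ev q p)).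
Proof. by move=> a u v; rewrite evDr rscaleDr (evZ q u a) -rscaleA. Qed.

(** The element [y q] of S, that is, the pairing P x Hom_R(P, R) -> S of the Morita context. *)
Definition rank1 (y : P) (q : dual P) : S :=
  endo_lact (linear_of (rank1_linear y q)).

Lemma lact_rank1 y q p : lact (rank1 y q) p = rscale y (ev q p).
Proof. exact: endo_lactE. Qed.

(** Since [y psi_j] y_j = y psi_j(y_j), the trace identity shows that the y_j generate P over S. *)
Lemma lact_rank1_trace (t : seq (P * dual P)) y : trace_one t ->
  \sum_(z <- t) lact (rank1 y z.2) z.1 = y.
Proof.
move=> tP; rewrite -[RHS]rscale1 -tP rscale_sumr.
by apply: eq_bigr => z _; rewrite lact_rank1.
Qed.

(** Applying g to p = sum [p psi_j] y_j gives g(p) = sum [p psi_j] g(y_j) = p a with a = sum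
    psi_j(g(y_j)). *)
Lemma double_centralizer (g : P -> P) : {morph g : p q / p + q} ->
    (forall s p, g (lact s p) = lact s (g p)) ->
  exists a, forall p, g p = rscale p a.
Proof.
move=> gD gS; have [/progenerator_bases[_ [t tP]] _] := P_progen.
exists (\sum_(z <- t) ev z.2 (g z.1)) => p.
rewrite -{1}(lact_rank1_trace p tP) (morphD_sum t _ gD) rscale_sumr.
by apply: eq_bigr => z _; rewrite gS lact_rank1.
Qed.

Fact dual_ract_linear (q : dual P) (s : S) :
  linear (fun p => ev q (lact s p) : (R^c)^o).
Proof.
move=> a u v; rewrite lactDr evDr (lact_rscale s u a); congr (_ + _).
exact: (evZ q (lact s u) a).
Qed.

Definition dual_ract (q : dual P) (s : S) : dual P :=
  linear_of (dual_ract_linear q s).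

Lemma ev_dual_ract q s p : ev (dual_ract q s) p = ev q (lact s p).
Proof. by []. Qed.

Fact dual_lact_linear (r : R) (q : dual P) :
  linear (fun p => r * ev q p : (R^c)^o).
Proof. by move=> a u v; rewrite evDr mulrDr (evZ q u a) mulrA. Qed.

Definition dual_lact (r : R) (q : dual P) : dual P :=
  linear_of (dual_lact_linear r q).

Lemma ev_dual_lact r q p : ev (dual_lact r q) p = r * ev q p.
Proof. by []. Qed.

Lemma dual_eq (q q' : dual P) : (forall p, ev q p = ev q' p) -> q = q'.
Proof. by move=> e; apply: linear_eq => z; exact: e. Qed.

Fact dual_ract_action : right_action dual_ract.
Proof.
split=> [q a b|q|q q' a|q a b]; apply: dual_eq => p.
- by rewrite !ev_dual_ract lactA.
- by rewrite ev_dual_ract lact1.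
- by rewrite evDl !ev_dual_ract.
- by rewrite evDl !ev_dual_ract lactDl evDr.
Qed.

(** From here to [dual_ract_rank1]: additivity, balance and associativity of the Morita context. *)
Lemma rank1Dl y y' q : rank1 (y + y') q = rank1 y q + rank1 y' q.
Proof. by apply: lact_inj => p; rewrite lactDl !lact_rank1 rscaleDl. Qed.
Lemma rank1Dr y q q' : rank1 y (q + q') = rank1 y q + rank1 y q'.
Proof. by apply: lact_inj => p; rewrite lactDl !lact_rank1 rscaleDr. Qed.
Lemma rank1Z y r q : rank1 (rscale y r) q = rank1 y (dual_lact r q).
Proof. by apply: lact_inj => p; rewrite !lact_rank1 rscaleA. Qed.
Lemma rank1_dual_ract y q s : rank1 y (dual_ract q s) = rank1 y q * s.
Proof. by apply: lact_inj => p; rewrite -lactA !lact_rank1 ev_dual_ract. Qed.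
Lemma rank1_lact s y q : rank1 (lact s y) q = s * rank1 y q.
Proof. by apply: lact_inj => p; rewrite -lactA !lact_rank1 lact_rscale. Qed.
Lemma dual_ract_rank1 q y q' : dual_ract q (rank1 y q') = dual_lact (ev q y) q'.
Proof.
by apply: dual_eq => p; rewrite ev_dual_ract ev_dual_lact lact_rank1 evZ.
Qed.

(** A dual basis over R says that sum [x_i phi_i] acts as the identity; it thus serves as a trace
    identity over S. *)
Lemma rank1_dual_basis (s : seq (P * dual P)) : dual_basis s ->
  \sum_(z <- s) rank1 z.1 z.2 = 1.
Proof.
move=> sP; apply: lact_inj => p; rewrite lact1 lact_suml -[RHS]sP.
by apply: eq_bigr => z _; rewrite lact_rank1.
Qed.

(** Since psi_j [y_j q] = psi_j(y_j) q, the psi_j generate Hom_R(P, R) as a right S-module. *)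
Lemma dual_ract_trace (t : seq (P * dual P)) q : trace_one t ->
  \sum_(z <- t) dual_ract z.2 (rank1 z.1 q) = q.
Proof.
move=> tP; apply: dual_eq => p; rewrite ev_suml -[RHS]mul1r -tP mulr_suml.
by apply: eq_bigr => z _; rewrite dual_ract_rank1.
Qed.

(** * The bilinear space attached to an anti-automorphism *)

Section Form.
Variables (theta : {rmorphism S -> S^c}) (theta' : S -> S).
Hypotheses (thetaK : cancel theta theta') (theta'K : cancel theta' theta).

Let thetaM s t : theta (s * t) = (theta t : S) * theta s.
Proof. exact: rmorphM. Qed.

Let thetaD s t : theta (s + t) = (theta s : S) + theta t.
Proof. exact: raddfD. Qed.

Let theta'M s t : theta' (s * t) = theta' t * theta' s.
Proof. by apply: (can_inj thetaK); rewrite thetaM !theta'K. Qed.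
Let theta'D s t : theta' (s + t) = theta' s + theta' t.
Proof. by apply: (can_inj thetaK); rewrite thetaD !theta'K. Qed.
Let theta'1 : theta' 1 = 1.
Proof. by apply: (can_inj thetaK); rewrite theta'K rmorph1. Qed.

Definition twisted_ract (p : P) (s : S) : P := lact (theta' s) p.

Fact twisted_ract_action : right_action twisted_ract.
Proof.
split=> [p a b|p|p q a|p a b]; rewrite /twisted_ract.
- by rewrite lactA theta'M.
- by rewrite theta'1 lact1.
- by rewrite lactDr.
- by rewrite theta'D lactDl.
Qed.

(* Hom_S(Q, P'), standing for the tensor product P' (x)_S P. *)
Definition form_value :=
  {linear rmod_of dual_ract_action -> rmod_of twisted_ract_action}.

Definition app (f : form_value) (q : dual P) : P := f q.

Lemma app_eq (f g : form_value) : (forall q, app f q = app g q) -> f = g.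
Proof. by move=> e; apply: linear_eq => z; exact: e. Qed.

Lemma appDl (f g : form_value) q : app (f + g) q = app f q + app g q.
Proof. by []. Qed.

Lemma appDr f (q q' : dual P) : app f (q + q') = app f q + app f q'.
Proof. exact: (raddfD f). Qed.

Lemma app_ract f (q : dual P) s :
  app f (dual_ract q s) = lact (theta' s) (app f q).
Proof. exact: (linearZZ f (s : S^c) q). Qed.

Lemma app_suml I (r : seq I) (F : I -> form_value) q :
  app (\sum_(i <- r) F i) q = \sum_(i <- r) app (F i) q.
Proof. exact: (sum_linearE r F q). Qed.

Lemma app_sumr f I (r : seq I) (F : I -> dual P) :
  app f (\sum_(i <- r) F i) = \sum_(i <- r) app f (F i).
Proof. exact: (linear_sum f). Qed.

Fact form_op0_linear (f : form_value) (r : R) :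
  linear (fun q : rmod_of dual_ract_action =>
            rscale (app f q) r : rmod_of twisted_ract_action).
Proof.
move=> a u v; rewrite appDr rscaleDl; congr (_ + _).
by rewrite (app_ract f u a) -lact_rscale.
Qed.
(** In terms of P' (x)_S P, R acts here through the factor P'. *)
Definition form_op0 f r : form_value := linear_of (form_op0_linear f r).

Fact form_op1_linear (f : form_value) (r : R) :
  linear (fun q : rmod_of dual_ract_action =>
            app f (dual_lact r q) : rmod_of twisted_ract_action).
Proof.
move=> a u v.
transitivity (app f (dual_ract (dual_lact r u) a + dual_lact r v)).
  by congr (app f _); apply: dual_eq => p; rewrite evDl ev_dual_lact evDl mulrDr.
by rewrite appDr app_ract.
Qed.
(** Here R acts through the factor P, because [(y r) q] = [y (r q)]. *)
Definition form_op1 f r : form_value := linear_of (form_op1_linear f r).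

Lemma app_op0 f r q : app (form_op0 f r) q = rscale (app f q) r.
Proof. by []. Qed.
Lemma app_op1 f r q : app (form_op1 f r) q = app f (dual_lact r q).
Proof. by []. Qed.

Fact form_op0_action : right_action form_op0.
Proof.
split=> [f a b|f|f g a|f a b]; apply: app_eq => q; rewrite ?appDl !app_op0.
- by rewrite rscaleA.
- by rewrite rscale1.
- by rewrite rscaleDl.
- by rewrite rscaleDr.
Qed.

Fact form_op1_action : right_action form_op1.
Proof.
split=> [f a b|f|f g a|f a b]; apply: app_eq => q; rewrite ?appDl !app_op1 //.
- by congr (app f _); apply: dual_eq => p; rewrite !ev_dual_lact mulrA.
- by congr (app f _); apply: dual_eq => p; rewrite !ev_dual_lact mul1r.
- rewrite -appDr; congr (app f _); apply: dual_eq => p.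
  by rewrite evDl !ev_dual_lact mulrDl.
Qed.

Fact form_op_comm f a b : form_op1 (form_op0 f a) b = form_op0 (form_op1 f b) a.
Proof. exact: app_eq. Qed.

Definition form_values : doubleModule R :=
  DoubleModule form_op0_action form_op1_action form_op_comm.

Fact form_linear (x y : P) :
  linear (fun q : rmod_of dual_ract_action =>
            lact (theta' (rank1 y q)) x : rmod_of twisted_ract_action).
Proof.
move=> a u v; rewrite rank1Dr theta'D lactDl; congr (_ + _).
by rewrite (rank1_dual_ract y u a) theta'M -lactA.
Qed.
Definition form (x y : P) : form_values := linear_of (form_linear x y).

Lemma app_form x y q : app (form x y) q = lact (theta' (rank1 y q)) x.
Proof. by []. Qed.

Fact form_Dl x x' y : form (x + x') y = form x y + form x' y.
Proof. by apply: app_eq => q; rewrite appDl !app_form lactDr. Qed.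
Fact form_Dr x y y' : form x (y + y') = form x y + form x y'.
Proof. by apply: app_eq => q; rewrite appDl !app_form rank1Dl theta'D lactDl. Qed.
Fact form_Zl x y (r : R) : form (rscale x r) y = op0 (form x y) r.
Proof. by apply: app_eq => q; rewrite app_op0 !app_form lact_rscale. Qed.
Fact form_Zr x y (r : R) : form x (rscale y r) = op1 (form x y) r.
Proof. by apply: app_eq => q; rewrite app_op1 !app_form rank1Z. Qed.

Definition form_space : bilinearSpace R :=
  BilinearSpace form_Dl form_Dr form_Zl form_Zr.

(** Since [(s y) q] = s [y q] and [theta'] reverses products, [theta' s] is the left adjoint of
    s. *)
Lemma form_lact s x y : form (lact (theta' s) x) y = form x (lact s y).
Proof.
by apply: app_eq => q; rewrite !app_form rank1_lact theta'M lactA.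
Qed.

(** The values b(x, y)(q) determine theta'([y q]), hence [y q], hence y = sum [y psi_j] y_j. *)
Lemma form_injr y y' : (forall x, form x y = form x y') -> y = y'.
Proof.
move=> yy'; have [/progenerator_bases[_ [t tP]] _] := P_progen.
have e q : rank1 y q = rank1 y' q.
  apply: (can_inj theta'K); apply: lact_inj => x.
  by rewrite -!app_form yy'.
rewrite -(lact_rank1_trace y tP) -(lact_rank1_trace y' tP).
by apply: eq_bigr => z _; rewrite e.
Qed.

(** Applying [theta'] to sum [x_i phi_i] = 1 gives x = sum b(x, x_i)(phi_i). *)
Lemma form_injl x x' : (forall y, form x y = form x' y) -> x = x'.
Proof.
move=> xx'; have [/progenerator_bases[[s sP] _] _] := P_progen.
have theta'1E (p : P) : p = \sum_(z <- s) lact (theta' (rank1 z.1 z.2)) p.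
  rewrite -lact_suml -(morphD_sum s _ theta'D).
  by rewrite rank1_dual_basis // theta'1 lact1.
rewrite (theta'1E x) (theta'1E x').
by apply: eq_bigr => z _; rewrite -!app_form xx'.
Qed.

(** For each q the map x |-> h(x)(q) is R-linear, so it is the action of some G(q) in S. It remains
    to find y with [y q] = theta(G(q)) for all q. *)
Lemma adj0_surj (h : {linear P -> dmod0 form_values}) :
  exists y, forall x, h x = form x y.
Proof.
have [/progenerator_bases[_ [t tP]] _] := P_progen.
have hq_lin q : linear (fun x : P => app (h x) q).
  by move=> a u v; rewrite linearP.
pose G q := endo_lact (linear_of (hq_lin q)).
have GE q x : lact (G q) x = app (h x) q by exact: endo_lactE.
have Gract q s : G (dual_ract q s) = theta' s * G q.
  by apply: lact_inj => x; rewrite -lactA !GE app_ract.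
(* Expanding q = sum psi_j [y_j q] gives G(q) = sum theta'([y_j q]) G(psi_j). Then theta(G(q)) = sum
   theta(G(psi_j)) [y_j q], which is [y q] for this y. *)
exists (\sum_(z <- t) lact (theta (G z.2) : S) z.1) => x; apply: app_eq => q.
rewrite app_form -GE; congr (lact _ x); apply: (can_inj thetaK).
rewrite theta'K; apply: lact_inj => p; rewrite lact_rank1 rscale_suml.
have -> : G q = \sum_(z <- t) theta' (rank1 z.1 q) * G z.2.
  apply: lact_inj => x'; rewrite GE -{1}(dual_ract_trace q tP) app_sumr lact_suml.
  by apply: eq_bigr => z _; rewrite app_ract -lactA GE.
rewrite (morphD_sum (f := theta : S -> S) t _ thetaD) lact_suml.
apply: eq_bigr => z _.
by rewrite thetaM theta'K -lactA lact_rank1 lact_rscale.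
Qed.

(** With y = sum x_i phi_i(y), h(y)(q) = sum h(x_i)(phi_i(y) q) = sum h(x_i)(phi_i [y q]) =
    theta'([y q]) x, where x = sum h(x_i)(phi_i). *)
Lemma adj1_surj (h : {linear P -> dmod1 form_values}) :
  exists x, forall y, h y = form x y.
Proof.
have [/progenerator_bases[[s sP] _] _] := P_progen.
exists (\sum_(z <- s) app (h z.1) z.2) => y; apply: app_eq => q.
rewrite app_form lact_sumr -{1}(sP y) (linear_sum h) app_suml.
apply: eq_bigr => z _; rewrite -app_ract dual_ract_rank1.
by rewrite (linear_rscale h).
Qed.

Lemma form_regular : regular form_space.
Proof.
split.
- have [x xP] := choice adj1_surj.
  exists x => [u|h].
    by apply: form_injl => y; rewrite -(xP (adj1 (u : bs_mod form_space))).
  by apply: linear_eq => y; exact: esym (xP h y).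
- have [y yP] := choice adj0_surj.
  exists y => [u|h].
    by apply: form_injr => x; rewrite -(yP (adj0 (u : bs_mod form_space))).
  by apply: linear_eq => z; exact: esym (yP h z).
Qed.

(** One has f(q) = sum f(psi_j [y_j q]) = sum theta'([y_j q]) f(psi_j). In particular the values of
    the form generate K additively. *)
Lemma form_span (t : seq (P * dual P)) (f : form_values) : trace_one t ->
  f = \sum_(z <- t) form (app f z.2) z.1.
Proof.
move=> tP; apply: app_eq => q; rewrite -{1}(dual_ract_trace q tP).
by rewrite app_sumr app_suml; apply: eq_bigr => z _; rewrite app_ract.
Qed.

Fact ev_app_linear (phi q : dual P) :
  linear (fun f : dmod0 form_values => ev phi (app f q) : (R^c)^o).
Proof.
move=> a f g; rewrite appDl evDr; congr (_ + _); exact: (evZ phi (app f q) a).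
Qed.

Lemma form_values_progenerator : progenerator (dmod0 form_values).
Proof.
have [/progenerator_bases[[s sP] [t tP]] _] := P_progen.
apply/progenerator_bases; split.
(* In f = sum b(f(psi_j), y_j), each f(psi_j) is expanded in the dual basis x_i, phi_i. *)
- exists [seq (form z.1 w.1 : dmod0 form_values, linear_of (ev_app_linear z.2 w.2))
           | w <- t, z <- s] => f.
  rewrite big_allpairs_dep /= [RHS](form_span f tP).
  apply: eq_bigr => w _; rewrite -[in RHS](sP (app f w.2)).
  rewrite (morphD_sum (f := form^~ w.1)) => [|x x']; last exact: form_Dl.
  by apply: eq_bigr => z _; rewrite form_Zl.
(* Here sum_i b(y_j, x_i)(phi_i) = y_j, so applying psi_j and summing over j gives 1. *)
- exists [seq (form w.1 z.1 : dmod0 form_values, linear_of (ev_app_linear w.2 z.2))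
           | w <- t, z <- s].
  rewrite /trace_one big_allpairs_dep /= -[RHS]tP; apply: eq_bigr => w _.
  rewrite -{2}[w.1]lact1 -theta'1 -(rank1_dual_basis sP).
  by rewrite (morphD_sum s _ theta'D) lact_suml ev_sumr.
Qed.

(** By regularity an endomorphism F satisfies F(b(x, y)) = b(x, g(y)) for some g. This g commutes
    with S, so the double centralizer property makes it right multiplication by some a, and F is
    [op1] by a because the form spans. *)
Lemma form_values_double_progenerator : double_progenerator form_values.
Proof.
split=> [|F]; first exact: form_values_progenerator.
have [/progenerator_bases[_ [t tP]] _] := P_progen.
have Fy_lin y : linear (fun x => F (form x y) : dmod0 form_values).
  move=> a u v; rewrite form_Dl raddfD; congr (_ + _).
  rewrite (form_Zl u y a).
  exact: (linear_rscale F (form u y : dm_bimodule form_values) a).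
have /choice[g gP] y := adj0_surj (linear_of (Fy_lin y)).
have gD : {morph g : y y' / y + y'}.
  by move=> y y'; apply: form_injr => x; rewrite form_Dr -!gP /= form_Dr raddfD.
have gS s y : g (lact s y) = lact s (g y).
  apply: form_injr => x; rewrite -form_lact -!gP /=.
  by rewrite form_lact.
have [a aP] := double_centralizer gD gS.
have Fa f : F f = op1 f a.
  rewrite (form_span f tP) linear_sum.
  rewrite [RHS](morphD_sum (f := fun k : form_values => op1 k a)) => [|k l].
    by apply: eq_bigr => z _; rewrite -form_Zr -aP; exact: gP.
  exact: (ractDl (op1_action form_values)).
exists a; split=> [f|b bP]; first exact: Fa.
apply: rscale_inj => y; apply: form_injr => x; rewrite !form_Zr -Fa.
exact: bP.
Qed.

(** As sigma(c) is central, sigma(c) q = q C(sigma(c)); f turns this into the action of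
    theta'(C(sigma(c))) = C(c), which is scaling by c. *)
Lemma form_values_type (C : center R -> S) (sigma : center R -> center R) :
    (forall c (p : P), lact (C c) p = rscale p (val c)) ->
    (forall c, theta (C c) = C (sigma c)) ->
  double_module_of_type form_values sigma.
Proof.
move=> CE Ctheta f c; apply: app_eq => q; rewrite app_op0 app_op1.
have -> : dual_lact (val (sigma c)) q = dual_ract q (C (sigma c)).
  apply: dual_eq => p; rewrite ev_dual_lact ev_dual_ract CE evZ.
  exact: (in_centerP _ (valP (sigma c))).
by rewrite app_ract -Ctheta thetaK CE.
Qed.

End Form.
End Morita.

(** * Centrality, and the passage from an anti-automorphism to a form *)

Section Correspondence.
Variable R : pzRingType.

(** A central z of S acts S-linearly, hence as right multiplication by some a in R; this action is
    also R-linear, so a is central. *)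
Lemma morita_central (S : algebraOver (center R)) :
  morita_equivalent_over (self_algebra R) S -> central S.
Proof.
move=> [P [P_progen PC]].
have surj (z : center S) : exists c, to_center S c = z.
  have zS s p : lact (val z) (lact s p : P) = lact s (lact (val z) p).
    by rewrite !lactA (in_centerP _ (valP z)).
  have [a aP] := double_centralizer P_progen (lactDr (val z)) zS.
  have a_center : a \in in_center (R := R).
    apply/in_centerP => r; apply: (rscale_inj P_progen) => p.
    by rewrite -!rscaleA -!aP lact_rscale.
  exists (Center a_center); apply: val_inj.
  by apply: (lact_inj P_progen) => p; rewrite PC aP.
have [c cP] := choice surj.
exists c => // a; apply: val_inj; apply: (rscale_inj P_progen) => p.
have /(congr1 val) /= e := cP (to_center S a).
by rewrite -[LHS](PC (c _)) e PC.
Qed.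

Lemma bilinear_of_antiaut (sigma : center R -> center R)
    (S : algebraOver (center R)) (theta : {rmorphism S -> S^c}) :
    morita_equivalent_over (self_algebra R) S ->
    bijective theta -> antiaut_of_type theta sigma ->
  exists B : bilinearSpace R,
    [/\ regular B, progenerator (bs_mod B), double_progenerator (bs_dmod B)
      & double_module_of_type (bs_dmod B) sigma].
Proof.
move=> [P [P_progen PC]] [theta' thetaK theta'K] theta_type.
exists (form_space P_progen thetaK theta'K); split.
- exact: form_regular.
- exact: P_progen.1.
- exact: form_values_double_progenerator.
- exact: form_values_type PC theta_type.
Qed.

(** * Adjoints of endomorphisms for a regular form *)

Section Adjoint.
Variables (B : bilinearSpace R).
Local Notation M := (bs_mod B).
Local Notation b := (@bs_form R B).
Local Notation endo := {linear M -> M}.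
Hypothesis B_regular : regular B.

Lemma bs_form_injr (y y' : M) : (forall x, b x y = b x y') -> y = y'.
Proof.
by move=> e; have [_ /bij_inj inj] := B_regular; apply/inj/linear_eq.
Qed.

Lemma bs_form_injl (x x' : M) : (forall y, b x y = b x' y) -> x = x'.
Proof.
by move=> e; have [/bij_inj inj _] := B_regular; apply/inj/linear_eq.
Qed.

Fact left_form_linear (s : endo) (y : M) :
  linear (fun x => b (s x) y : dmod0 (bs_dmod B)).
Proof.
move=> a u v; rewrite linearP bs_formDl; congr (_ + _).
exact: (bs_formZl (s u) y a).
Qed.

Fact right_form_linear (s : endo) (x : M) :
  linear (fun y => b x (s y) : dmod1 (bs_dmod B)).
Proof.
move=> a u v; rewrite linearP bs_formDr; congr (_ + _).
exact: (bs_formZr x (s u) a).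
Qed.

(** For fixed y, x |-> b(s x, y) is a linear map into K_0, so regularity represents it by a vector
    t(y). *)
Lemma right_adjoint_exists (s : endo) :
  exists t : endo, forall x y, b (s x) y = b x (t y).
Proof.
have [_ [c _ adjK]] := B_regular.
pose t0 y := c (linear_of (left_form_linear s y)).
have t0E x y : b (s x) y = b x (t0 y).
  exact: (congr1 (fun h : {linear M -> dmod0 (bs_dmod B)} => h x)
            (esym (adjK (linear_of (left_form_linear s y))))).
(* Linearity of t is tested against all b(x, -). *)
have t0_lin : linear t0.
  move=> a u v; apply: bs_form_injr => x.
  rewrite -t0E !bs_formDr -t0E; congr (_ + _).
  by rewrite (bs_formZr (s x) u a) t0E -(bs_formZr x (t0 u) a).
by exists (linear_of t0_lin) => x y; exact: t0E.
Qed.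

Lemma left_adjoint_exists (s : endo) :
  exists t : endo, forall x y, b (t x) y = b x (s y).
Proof.
have [[c _ adjK] _] := B_regular.
pose t0 x := c (linear_of (right_form_linear s x)).
have t0E x y : b (t0 x) y = b x (s y).
  exact: (congr1 (fun h : {linear M -> dmod1 (bs_dmod B)} => h y)
            (adjK (linear_of (right_form_linear s x)))).
have t0_lin : linear t0.
  move=> a u v; apply: bs_form_injl => y.
  rewrite t0E !bs_formDl t0E; congr (_ + _).
  by rewrite (bs_formZl u (s y) a) -t0E -(bs_formZl (t0 u) y a).
by exists (linear_of t0_lin) => x y; exact: t0E.
Qed.

(** The target is the opposite ring: b(s t x, y) = b(x, t' s' y), where primes denote adjoints. *)
Definition adjoint (s : endo) : endo^c := projT1 (cid (right_adjoint_exists s)).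

Lemma adjointE (s : endo) x y : b (s x) y = b x ((adjoint s : endo) y).
Proof. exact: (projT2 (cid (right_adjoint_exists s))). Qed.

Lemma adjoint_uniq (s t : endo) :
  (forall x y, b (s x) y = b x (t y)) -> adjoint s = t.
Proof.
move=> e; apply: linear_eq => y; apply: bs_form_injr => x.
by rewrite -adjointE e.
Qed.

Fact adjoint_zmod_morphism : zmod_morphism adjoint.
Proof.
have adjD s t : adjoint (s + t) = adjoint s + adjoint t.
  by apply: adjoint_uniq => x y; rewrite bs_formDl bs_formDr -!adjointE.
by move=> s t; apply: (addIr (adjoint t)); rewrite -adjD !subrK.
Qed.

Fact adjoint_monoid_morphism : monoid_morphism adjoint.
Proof.
split=> [|s t]; apply: adjoint_uniq => x y //.
exact: etrans (adjointE s (t x) y) (adjointE t x _).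
Qed.

(** Left adjoints, which exist by the other half of regularity, give the inverse map. *)
Lemma adjoint_bij : bijective adjoint.
Proof.
have [c cP] := choice left_adjoint_exists.
exists c => s; last by apply: adjoint_uniq => x y; exact: cP.
apply: linear_eq => x; apply: bs_form_injl => y.
by rewrite cP -adjointE.
Qed.

HB.instance Definition _ :=
  GRing.isZmodMorphism.Build endo endo^c adjoint adjoint_zmod_morphism.
HB.instance Definition _ :=
  GRing.isMonoidMorphism.Build endo endo^c adjoint adjoint_monoid_morphism.

End Adjoint.

(** * The endomorphism algebra of a right module, and the passage from a form to an
    anti-automorphism *)

Section EndomorphismAlgebra.
Variable M : lmodType R^c.

Fact central_scale_linear (c : center R) : linear (fun p : M => rscale p (val c)).
Proof.
move=> a u v; rewrite rscaleDl; congr (_ + _).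
transitivity (rscale u ((a : R) * val c)); first exact: (rscaleA u (a : R)).
by rewrite -(in_centerP _ (valP c)) -rscaleA.
Qed.
Definition central_scale c : {linear M -> M} :=
  linear_of (central_scale_linear c).

Fact central_scale_zmod_morphism : zmod_morphism central_scale.
Proof. by move=> c d; apply: linear_eq => p; exact: scalerBl. Qed.
Fact central_scale_monoid_morphism : monoid_morphism central_scale.
Proof.
split=> [|c d]; apply: linear_eq => p; first exact: rscale1.
by rewrite [RHS]rscaleA mulrC.
Qed.

HB.instance Definition _ := GRing.isZmodMorphism.Build
  (center R) {linear M -> M} central_scale central_scale_zmod_morphism.
HB.instance Definition _ := GRing.isMonoidMorphism.Build
  (center R) {linear M -> M} central_scale central_scale_monoid_morphism.

Fact central_scale_center c : central_scale c \in @in_center {linear M -> M}.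
Proof.
by apply/in_centerP => f; apply: linear_eq => p;
  exact: esym (linear_rscale f p _).
Qed.

Definition endo_algebra : algebraOver (center R) :=
  AlgebraOver central_scale_center.

Definition endo_bimodule : bimodule endo_algebra R :=
  @Bimodule endo_algebra R M (fun f p => f p) (fun _ _ _ => erefl)
    (fun _ => erefl) (fun f => raddfD f) (fun _ _ _ => erefl)
    (fun f => linear_rscale f).

Lemma endo_algebra_morita : progenerator M ->
  morita_equivalent_over (self_algebra R) endo_algebra.
Proof.
move=> M_progen; exists endo_bimodule; split=> //; split=> // f.
by exists f; split=> // g fg; apply: linear_eq.
Qed.

End EndomorphismAlgebra.

Lemma antiaut_of_bilinear (sigma : center R -> center R) (B : bilinearSpace R) :
    regular B -> progenerator (bs_mod B) ->
    double_module_of_type (bs_dmod B) sigma ->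
  exists S : algebraOver (center R),
    morita_equivalent_over (self_algebra R) S /\
    exists theta : {rmorphism S -> S^c},
      bijective theta /\ antiaut_of_type theta sigma.
Proof.
move=> B_regular M_progen B_type; exists (endo_algebra (bs_mod B)).
split; first exact: endo_algebra_morita.
exists (adjoint B_regular); split; first exact: adjoint_bij.
(* The type of K moves c across the form: b(x c, y) = b(x, y sigma(c)). *)
move=> c; apply: adjoint_uniq => x y.
by rewrite bs_formZl B_type -bs_formZr.
Qed.

End Correspondence.

Theorem proposition4p3 (R : pzRingType)
    (sigma : {rmorphism center R -> center R}) (sigma_aut : bijective sigma) :
  (forall S : algebraOver (center R),
     morita_equivalent_over (self_algebra R) S -> central S) /\
  ((exists S : algebraOver (center R),
      morita_equivalent_over (self_algebra R) S /\
      exists theta : {rmorphism S -> S^c},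
        bijective theta /\ antiaut_of_type theta sigma) <->
   (exists B : bilinearSpace R,
      [/\ regular B, progenerator (bs_mod B), double_progenerator (bs_dmod B)
        & double_module_of_type (bs_dmod B) sigma])).
Proof.
split=> [S|]; first exact: morita_central.
split=> [[S [S_morita [theta [theta_bij theta_type]]]]|
         [B [B_reg M_progen _ B_type]]].
  exact: bilinear_of_antiaut S_morita theta_bij theta_type.
exact: antiaut_of_bilinear B_reg M_progen B_type.
Qed.
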